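(* Let $X$ be an ordered Banach space with positive cone $X_+ \neq \{0\}$, let $J = \mathbb{N}_0$ or $J = [0,\infty)$, and let $\mathcal{T} = (T_t)_{t \in J}$ be a positive operator semigroup on $X$. Suppose that the following two assumptions are satisfied: (a) For each vector $0 \neq x \in X_+$ there exists a time $t_x \in J$ such that $T_{t_x} x$ is an almost interior point of $X_+$. (b) The semigroup $\mathcal{T}$ is bounded and there exists a time $\tau \in J$ such that $T_\tau$ is quasi-compact. Then $T_t$ converges with respect to the operator norm as $t \to \infty$. If the limit operator $Q := \lim_{t \to \infty} T_t$ is not zero, then it is of the form $Q = y' \otimes y$, where $y \in X$ is an almost interior point of $X_+$ and a fixed point of $\mathcal{T}$ (i.e. $T_t y = y$ for all $t \in J$), and $y' \in X'$ is a strictly positive functional and a fixed point of the dual semigroup $\mathcal{T}' := (T_t')_{t\in J}$ (i.e. $T_t' y' = y'$ for all $t\in J$).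
   Context: An ordered Banach space is a real Banach space $X$ together with a non-empty closed subset $X_+ \subseteq X$ (the positive cone) such that $\alpha X_+ + \beta X_+ \subseteq X_+$ for all real $\alpha,\beta \ge 0$ and $X_+ \cap (-X_+) = \{0\}$. $X'$ is the dual Banach space of $X$, and a functional $x' \in X'$ is called positive if $\langle x',x\rangle \ge 0$ for all $x \in X_+$. A functional $x' \in X'$ is called strictly positive if $\langle x',x\rangle > 0$ for all $0 \neq x \in X_+$. A vector $x \in X$ is called an almost interior point of $X_+$ if $\langle x',x\rangle > 0$ for every non-zero positive functional $x' \in X'$. $\mathcal{L}(X)$ is the space of bounded linear operators on $X$. Let $J = \mathbb{N}_0 = \{0,1,2,\dots\}$ or $J = [0,\infty)$. An operator semigroup on $X$ is a family $(T_t)_{t \in J}$ in $\mathcal{L}(X)$ with $T_0 = \mathrm{id}$ and $T_{t+s} = T_tT_s$ for all $s,t \in J$; no continuity in $t$ is assumed. It is positive if $T_t X_+ \subseteq X_+$ for all $t \in J$, and bounded if $\sup_{t\in J}\|T_t\| < \infty$. An operator $T \in \mathcal{L}(X)$ is quasi-compact if there exist an integer $m \in \mathbb{N} = \{1,2,\dots\}$ and a compact linear operator $K$ on $X$ such that $\|T^m - K\| < 1$. $T_t'$ denotes the dual operator of $T_t$. For $y \in X$ and $y' \in X'$, the operator $y' \otimes y \in \mathcal{L}(X)$ is $(y'\otimes y)z = \langle y',z\rangle y$. *)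

(* Defs.v *)
From HB Require Import structures.
From mathcomp Require Import all_boot all_order all_algebra.
From mathcomp Require Import all_classical all_reals all_analysis.

Set Implicit Arguments.
Unset Strict Implicit.
Unset Printing Implicit Defensive.

Import Order.TTheory GRing.Theory Num.Theory.
Import numFieldNormedType.Exports.

Local Open Scope classical_set_scope.
Local Open Scope ring_scope.

(* A linear map between normed spaces is bounded iff it is continuous
   (linear_bounded_continuous). *)
#[short(type="boundedLinear")]
HB.structure Definition BoundedLinear (R : realType) (X Y : normedModType R) :=
  {f of @GRing.Linear R X Y *:%R f & @Continuous X Y f}.

Notation "''L' ( X )" := (boundedLinear X X)
  (at level 8, format "''L' ( X )") : type_scope.

Section comp_bounded.
Context (R : realType) (X Y Z : normedModType R).
Context (g : boundedLinear Y Z) (f : boundedLinear X Y).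
HB.instance Definition _ := GRing.Linear.on (g \o f).
End comp_bounded.

Definition dual (R : realType) (X : normedModType R) := boundedLinear X R^o.

Lemma boundedLinearP (R : realType) (X Y : normedModType R)
    (f g : boundedLinear X Y) :
  f = g <-> (f : X -> Y) = g.
Proof.
split=> [->//|]; move: f g => [f [[a] [b] [c]]] [g [[a'] [b'] [c']]] /= fg.
rewrite {}fg in a b c *.
by rewrite (Prop_irrelevance a a') (Prop_irrelevance b b')
  (Prop_irrelevance c c').
Qed.

(* Meant for bounded linear f (and differences of such), where the supremum is
   over a nonempty set bounded above; on other maps sup may be junk. *)
Definition opnorm (R : realType) (X Y : normedModType R) (f : X -> Y) : R :=
  sup [set `|f x| | x in [set x | `|x| <= 1]].

Definition dual_op (R : realType) (X : normedModType R) (T : 'L(X))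
    (x' : dual X) : dual X := (x' \o T : boundedLinear X R^o).

Definition tensor (R : realType) (X : normedModType R) (y' : dual X) (y : X) :
  X -> X := fun z => y' z *: y.

Section tensor_bounded.
Context (R : realType) (X : normedModType R) (y' : dual X) (y : X).

Let tensor_linear : linear (tensor y' y).
Proof. by move=> a u v; rewrite /tensor linearP scalerDl scalerA. Qed.

Let tensor_continuous : continuous (tensor y' y).
Proof. by move=> z; apply: cvgZr_tmp; exact: (@cts_fun _ _ y'). Qed.

HB.instance Definition _ := GRing.isLinear.Build R X X *:%R (tensor y' y)
  tensor_linear.
HB.instance Definition _ := isContinuous.Build X X (tensor y' y)
  tensor_continuous.
End tensor_bounded.

Section ordered_Banach_space.
Context (R : realType) (X : completeNormedModType R).

Record positive_cone (P : set X) : Prop := {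
  cone_nonempty : P !=set0 ;
  cone_closed : closed P ;
  cone_combination : forall (a b : R) (x y : X), 0 <= a -> 0 <= b ->
    P x -> P y -> P (a *: x + b *: y) ;
  cone_pointed : P `&` [set - x | x in P] = [set 0] }.

Definition positive_functional (P : set X) (x' : dual X) :=
  forall x, P x -> 0 <= x' x.

Definition strictly_positive (P : set X) (x' : dual X) :=
  forall x, P x -> x <> 0 -> 0 < x' x.

Definition almost_interior (P : set X) (x : X) :=
  forall x' : dual X, positive_functional P x' -> (x' : X -> R^o) <> 0 ->
    0 < x' x.

(* Families indexed by J `<=` R are total functions on R whose values outside
   J are irrelevant. *)
Record operator_semigroup (J : set R) (T : R -> 'L(X)) : Prop := {
  semigroup0 : T 0 = idfun :> (X -> X) ;
  semigroupD : forall s t, J s -> J t -> T (t + s) = T t \o T s :> (X -> X) }.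

Definition positive_semigroup (P : set X) (J : set R) (T : R -> 'L(X)) :=
  forall t, J t -> T t @` P `<=` P.

Definition bounded_semigroup (J : set R) (T : R -> 'L(X)) :=
  has_ubound [set opnorm (T t) | t in J].

Definition compact_operator (K : {linear X -> X}) :=
  precompact (K @` [set x | `|x| <= 1]).

Definition quasi_compact (T : 'L(X)) :=
  exists (m : nat) (K : {linear X -> X}),
    [/\ (0 < m)%N, compact_operator K & opnorm (iter m T \- K) < 1].

Definition cvg_opnorm (J : set R) (T : R -> 'L(X)) (Q : 'L(X)) :=
  (fun t => opnorm (T t \- Q)) @ within J (pinfty_nbhs R) --> (0 : R).

End ordered_Banach_space.

(* Main.v *)
Require Import Defs.
From HB Require Import structures.
From mathcomp Require Import all_boot all_order all_algebra.
From mathcomp Require Import all_classical all_reals all_analysis.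
From mathcomp Require Import ring lra.

Set Implicit Arguments.
Unset Strict Implicit.
Unset Printing Implicit Defensive.

Import Order.TTheory GRing.Theory Num.Theory.
Import numFieldNormedType.Exports.

Local Open Scope classical_set_scope.
Local Open Scope ring_scope.

(** Boundedness and quasi-compactness together say that, for large t, all the
    operators T_t map the unit ball into a small neighbourhood of one fixed
    finite set: a power of the quasi-compact operator is a compact operator plus
    a strict contraction, and powers shrink the part that is not compact
    ([quasi_compact_asymptotically_compact]).  Hence the orbits converge along
    every ultrafilter of times tending to infinity, and the limits define
    bounded positive operators that commute with the semigroup and have the
    vectors whose orbit tends to 0 as their common kernel.

    Among these limit operators there is a projection E.  Take any limit
    operator S; if T_s x and T_t x are both close to S x, then T_(t - s) nearly
    fixes S x, so a limit operator E along such differences t - s satisfies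
    E S = S.  Then S (x - E x) = 0, so x - E x lies in the common kernel, and
    E (x - E x) = 0 ([limit_projection]).  On its range the semigroup is
    recurrent: along suitable times T_t x comes back to x.  Therefore T_t x in P
    already forces x in P there ([positive_of_semigroup_positive]).

    Positivity makes the range of E at most one-dimensional.  Hahn-Banach shows
    that P - R_+ v is dense when v is almost interior; since E maps the unit
    ball to a totally bounded set, v then dominates a positive multiple of
    every vector of the range ([almost_interior_absorbs]).  Let u be a nonzero
    positive vector of the range and z another vector of it with - z not in P.
    The largest l with u - l z in P exists; if u - l z were nonzero, the
    irreducibility assumption would send it to an almost interior vector, l
    could be enlarged after applying some T_t, and by recurrence it could be
    enlarged outright.  So u = l z ([fixed_collinear]).  Boundedness and
    recurrence force T_t u = u, so E has rank one or is 0 and in both cases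
    T_t E = E.

    Finally x - E x always lies in the kernel of E, which gives strong
    convergence T_t x --> E x; since the images of the unit ball are almost
    covered by finitely many points, the convergence is uniform on that ball
    ([stable_cvg_opnorm]). *)

(** * Sublinear functionals and the Hahn-Banach theorem *)

Section sublinear.
Context (R : realType) (V : lmodType R).
Implicit Types (p q : V -> R) (x y : V).

Definition sublinear p := forall (a b : R) x y,
  0 <= a -> 0 <= b -> p (a *: x + b *: y) <= a * p x + b * p y.

Lemma sublinear0 p : sublinear p -> p 0 = 0.
Proof.
move=> pS; apply/eqP; rewrite eq_le; apply/andP; split.
  by have := pS 0 0 0 0 (lexx _) (lexx _); rewrite !scale0r addr0 !mul0r addr0.
have := pS 1 1 0 0 ler01 ler01; rewrite scaler0 addr0 !mul1r; lra.
Qed.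

Lemma sublinearD p x y : sublinear p -> p (x + y) <= p x + p y.
Proof. by move=> /(_ 1 1 x y ler01 ler01); rewrite !scale1r !mul1r. Qed.

Lemma sublinearN p x : sublinear p -> - p (- x) <= p x.
Proof.
move=> pS; have := sublinearD x (- x) pS.
by rewrite subrr sublinear0//; lra.
Qed.

Lemma sublinearZ p (a : R) x : sublinear p -> 0 <= a -> p (a *: x) = a * p x.
Proof.
move=> pS a0; apply/eqP; rewrite eq_le; apply/andP; split.
  by have := pS a 0 x 0 a0 (lexx _); rewrite scaler0 addr0 mul0r addr0.
have [->|an0] := eqVneq a 0; first by rewrite mul0r scale0r sublinear0.
have ap : 0 < a by rewrite lt_def an0.
have := pS a^-1 0 (a *: x) 0; rewrite invr_ge0 => /(_ a0 (lexx _)).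
by rewrite scaler0 addr0 mul0r addr0 scalerA mulVf// scale1r ler_pdivlMl.
Qed.

Lemma le_mul_inf (A : set R) (a c : R) : A !=set0 -> 0 <= a ->
  (forall u, A u -> c <= a * u) -> c <= a * inf A.
Proof.
move=> A0 a0 ac; have [az|an0] := eqVneq a 0.
  by case: A0 => u /ac; rewrite az !mul0r.
have ap : 0 < a by rewrite lt_def an0.
rewrite -ler_pdivrMl//; apply: lb_le_inf => // u /ac.
by rewrite -ler_pdivrMl.
Qed.

(** The three sublinear functionals needed below (a tilted functional, the
    infimum of a chain, the distance to a convex cone) are all infima of
    families that are directed in this sense. *)
Lemma sublinear_inf (I : Type) (D : set I) (F : I -> V -> R) :
  D !=set0 -> (forall x, has_lbound [set F i x | i in D]) ->
  (forall i j (a b : R) x y, D i -> D j -> 0 <= a -> 0 <= b ->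
    exists2 k, D k & F k (a *: x + b *: y) <= a * F i x + b * F j y) ->
  sublinear (fun x => inf [set F i x | i in D]).
Proof.
move=> [i0 Di0] lbF dirF a b x y a0 b0.
rewrite -lerBlDr; apply: le_mul_inf => //; first by exists (F i0 x), i0.
move=> _ [i Di <-]; rewrite lerBlDl -lerBlDr.
apply: le_mul_inf => //; first by exists (F i0 y), i0.
move=> _ [j Dj <-]; rewrite lerBlDl.
have [k Dk Fk] := dirF i j a b x y Di Dj a0 b0.
by apply: le_trans Fk; apply: ge_inf; [exact: lbF|exists k].
Qed.

(** The functional p' x = inf_(t >= 0) (p (x + t y) - t p y) lies below p and
    satisfies p' (- y) <= - p y: it is the means of forcing p to be additive in
    the direction y. *)
Lemma sublinear_tilt p y : sublinear p -> exists p', [/\ sublinear p',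
  (forall x, p' x <= p x) & forall x, p' x <= p (x + y) - p y].
Proof.
move=> pS; pose F (t : R) x := p (x + t *: y) - t * p y.
have lbF x : has_lbound [set F t x | t in [set t | 0 <= t]].
  exists (- p (- x)) => _ [t /= t0 <-]; rewrite /F lerBrDr.
  have := sublinearD (- x) (x + t *: y) pS.
  by rewrite addKr sublinearZ//; lra.
exists (fun x => inf [set F t x | t in [set t | 0 <= t]]); split.
- apply: sublinear_inf => //; first by exists 0 => /=.
  move=> i j a b u v /= i0 j0 a0 b0; exists (a * i + b * j).
    by rewrite addr_ge0// mulr_ge0.
  have := pS a b (u + i *: y) (v + j *: y) a0 b0; rewrite /F.
  rewrite !scalerDr !scalerA addrACA -scalerDl; lra.
- move=> x; apply: (@le_trans _ _ (F 0 x)); last first.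
    by rewrite /F scale0r addr0 mul0r subr0.
  by apply: ge_inf => //; exists 0 => /=.
- move=> x; apply: (@le_trans _ _ (F 1 x)); last by rewrite /F scale1r mul1r.
  by apply: ge_inf => //; exists 1 => //=.
Qed.

(** Zorn's lemma for the reversed pointwise order: a chain is bounded below
    because every sublinear q <= p satisfies q x >= - p (- x). *)
Lemma minimal_sublinear p : sublinear p -> exists q, [/\ sublinear q,
  (forall x, q x <= p x) &
  forall q', sublinear q' -> (forall x, q' x <= q x) -> q' = q].
Proof.
move=> pS; pose S := {q | sublinear q /\ forall x, q x <= p x}.
pose le (f g : S) := `[< forall x, sval g x <= sval f x >].
have [||||[q [qS qp]] qmin] := @Zorn S le.
- by move=> f; apply/asboolP.
- move=> f g h /asboolP fg /asboolP gh; apply/asboolP => x.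
  exact: le_trans (gh x) (fg x).
- move=> [f fP] [g gP] /asboolP /= fg /asboolP /= gf.
  by apply: eq_exist => /=; apply/funext => x; apply/eqP; rewrite eq_le fg gf.
- move=> A Atot; have [->|/set0P A0] := eqVneq A set0.
    by exists (exist _ p (conj pS (fun x => lexx _))).
  have lbA x : has_lbound [set sval f x | f in A].
    exists (- p (- x)) => _ [[f [fS fp]] Af <-] /=.
    by apply: le_trans (sublinearN x fS); rewrite lerN2.
  have mS : sublinear (fun x => inf [set sval f x | f in A]).
    apply: sublinear_inf => // f g a b x y Af Ag a0 b0.
    have [/asboolP fg|/asboolP gf] := Atot f g Af Ag.
      exists g => //; apply: le_trans ((svalP g).1 _ _ _ _ a0 b0) _.
      by rewrite lerD2r ler_wpM2l.
    exists f => //; apply: le_trans ((svalP f).1 _ _ _ _ a0 b0) _.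
    by rewrite lerD2l ler_wpM2l.
  have mle f x : A f -> inf [set sval f x | f in A] <= sval f x.
    by move=> Af; apply: ge_inf => //; exists f.
  have mp x : inf [set sval f x | f in A] <= p x.
    by case: A0 => f Af; apply: le_trans (mle f x Af) ((svalP f).2 x).
  exists (exist _ _ (conj mS mp) : S) => f Af; apply/asboolP => x.
  exact: mle.
exists q; split=> // q' q'S q'q.
have q'p x : q' x <= p x by exact: le_trans (q'q x) (qp x).
have q'min := qmin (exist _ _ (conj q'S q'p) : S).
by have /(congr1 sval) := q'min (asboolT q'q).
Qed.

(** A minimal sublinear functional is linear, since it coincides with all its
    tilts; working with sublinear functionals defined everywhere avoids partial
    linear maps.  A first tilt at [x0] secures equality there. *)
Lemma hahn_banach p (x0 : V) : sublinear p -> exists f : {linear V -> R^o},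
  (forall x, f x <= p x) /\ f x0 = p x0.
Proof.
move=> pS; have [p0 [p0S p0p p0x0]] := sublinear_tilt x0 pS.
have [q [qS qp0 qmin]] := minimal_sublinear p0S.
have qD x y : q (x + y) = q x + q y.
  apply/eqP; rewrite eq_le sublinearD//=.
  have [q' [q'S q'q q'y]] := sublinear_tilt y qS.
  by rewrite -lerBrDr -{1}(qmin _ q'S q'q).
have qN x : q (- x) = - q x.
  by have := qD x (- x); rewrite subrr sublinear0//; lra.
have qZ a x : q (a *: x) = a * q x.
  have [a0|/ltW a0] := leP 0 a; first exact: sublinearZ.
  by rewrite -[a in LHS]opprK scaleNr qN sublinearZ ?oppr_ge0// mulNr opprK.
have ql : linear (q : V -> R^o) by move=> a x y; rewrite qD qZ.
pose L := GRing.isLinear.Build R V R^o *:%R _ ql.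
pose f : {linear V -> R^o} := HB.pack (q : V -> R^o) L.
exists f; split=> [x|]; first exact: le_trans (qp0 x) (p0p x).
apply/eqP; rewrite eq_le (le_trans (qp0 _) (p0p _))/=.
have := le_trans (qp0 (- x0)) (p0x0 (- x0)).
by rewrite qN addNr sublinear0// sub0r lerN2.
Qed.

End sublinear.

(** * Bounded linear maps and separation from closed cones *)

Section bounded_linear_maps.
Context (R : realType) (X Y : normedModType R).

Lemma bounded_linear_map (f : X -> Y) (C : R) :
  linear f -> (forall x, `|f x| <= C * `|x|) ->
  exists g : boundedLinear X Y, g = f :> (X -> Y).
Proof.
move=> fL fC; pose L := GRing.isLinear.Build R X Y *:%R _ fL.
pose h : {linear X -> Y} := HB.pack f L.
have hc : continuous h.
  apply/linear_bounded_continuous/linear_boundedP.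
  exists C; split=> [|r /ltW Cr x]; first exact: num_real.
  by apply: le_trans (fC x) _; exact: ler_wpM2r.
pose K := isContinuous.Build X Y f hc.
pose g : boundedLinear X Y := HB.pack f L K.
by exists g.
Qed.

Lemma bounded_linear_bound (f : boundedLinear X Y) :
  exists2 C : R, 0 < C & forall x, `|f x| <= C * `|x|.
Proof.
have /linear_bounded_continuous/linear_boundedP := @cts_fun _ _ f.
by move=> /pinfty_ex_gt0 [C C0 fC]; exists C.
Qed.

Lemma opnorm_le (f : X -> Y) (C : R) :
  (forall x, `|x| <= 1 -> `|f x| <= C) -> opnorm f <= C.
Proof.
move=> fC; apply: ge_sup; first by exists `|f 0|, 0; rewrite //= normr0.
by move=> _ [x x1 <-]; exact: fC.
Qed.

(** Some a priori bound on the unit ball is required for the supremum that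
    defines [opnorm] to be meaningful. *)
Lemma le_opnorm (f : {linear X -> Y}) (C : R) x :
  (forall x, `|x| <= 1 -> `|f x| <= C) -> `|f x| <= opnorm f * `|x|.
Proof.
move=> fC; have [->|x0] := eqVneq x 0; first by rewrite linear0 !normr0 mulr0.
have xp : 0 < `|x| by rewrite normr_gt0.
rewrite -ler_pdivrMr// mulrC.
have -> : `|x|^-1 * `|f x| = `|f (`|x|^-1 *: x)|.
  by rewrite linearZ/= normrZ normfV normr_id.
apply: ub_le_sup; first by exists C => _ [z z1 <-]; exact: fC.
exists (`|x|^-1 *: x) => //=.
by rewrite normrZ normfV normr_id mulVf// normr_eq0.
Qed.

End bounded_linear_maps.

Lemma opnorm_ge0 (R : realType) (X Y : normedModType R) (f : X -> Y) :
  0 <= opnorm f.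
Proof.
rewrite /opnorm; set A := [set _ | _ in _].
have [hs|/sup_out -> //] := pselect (has_sup A).
apply: (@le_trans _ _ `|f 0|) => //; apply: ub_le_sup; first by case: hs.
by exists 0; rewrite //= normr0.
Qed.

Lemma rank_one_functional (R : realType) (X : normedModType R) (E : 'L(X))
    (u : X) : u <> 0 -> (forall x, exists a : R, E x = a *: u) ->
  exists y' : dual X, forall x, E x = y' x *: u.
Proof.
move=> un0 /choice [f Ef]; have [M _ EM] := bounded_linear_bound E.
have un : 0 < `|u| by rewrite normr_gt0; exact/eqP.
have uI : injective (fun a : R => a *: u).
  move=> a b /= /eqP; rewrite -subr_eq0 -scalerBl scaler_eq0 subr_eq0.
  by case/orP => /eqP.
have [||y' y'f] := @bounded_linear_map R X R^o f (M / `|u|).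
- by move=> a x y; apply: uI; rewrite -Ef linearP/= !Ef scalerA -scalerDl.
- by move=> x; rewrite mulrAC ler_pdivlMr// -normrZ -Ef.
- by exists y' => x; rewrite y'f.
Qed.

Section approximation.
Context (R : realType) (X : normedModType R).

Lemma closed_approx (C : set X) (x : X) : closed C ->
  (forall e : R, 0 < e -> exists2 y, C y & `|x - y| <= e) -> C x.
Proof.
move=> cC aC; apply: contrapT => nCx.
have : nbhs x (~` C) by apply: open_nbhs_nbhs; split => //; exact: closed_openC.
move=> /nbhs_normP [e /= e0 eC].
have [y Cy xy] := aC (e / 2) (divr_gt0 e0 (ltr0Sn _ _)).
by apply: (eC y) Cy; rewrite /= (le_lt_trans xy)//; lra.
Qed.

Lemma closure_approx (D : set X) (x : X) (e : R) : closure D x -> 0 < e ->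
  exists2 y, D y & `|x - y| <= e.
Proof.
move=> Dx e0; have [y [Dy]] := Dx _ (nbhsx_ballx x _ e0).
by rewrite -ball_normE => /ltW; exists y.
Qed.

Definition convex_cone (C : set X) := [/\ C 0 & forall (a b : R) (x y : X),
  0 <= a -> 0 <= b -> C x -> C y -> C (a *: x + b *: y)].

Lemma convex_cone_closure (D : set X) :
  convex_cone D -> convex_cone (closure D).
Proof.
move=> [D0 DD]; split; first exact: subset_closure.
move=> a b x y a0 b0 Dx Dy; apply: closed_approx; first exact: closed_closure.
move=> e e0; have ab0 : 0 < a + b + 1 by rewrite ltr_wpDl// addr_ge0.
have d0 : 0 < e / (a + b + 1) by rewrite divr_gt0.
have [x' Dx' xx'] := closure_approx Dx d0.
have [y' Dy' yy'] := closure_approx Dy d0.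
exists (a *: x' + b *: y'); first by apply: subset_closure; exact: DD.
rewrite opprD addrACA -!scalerBr (le_trans (ler_normD _ _))//.
rewrite !normrZ !ger0_norm//.
rewrite (le_trans (lerD (ler_wpM2l a0 xx') (ler_wpM2l b0 yy')))//.
by rewrite -mulrDl mulrA ler_pdivrMr// mulrC ler_pM2l// lerDl.
Qed.

(** Hahn-Banach for the sublinear functional given by the distance to C; it
    vanishes on C, is positive at x, and is at most the norm, which makes the
    resulting functional continuous. *)
Lemma cone_separation (C : set X) (x : X) : closed C -> convex_cone C ->
  ~ C x -> exists phi : dual X, (forall c, C c -> 0 <= phi c) /\ phi x < 0.
Proof.
move=> cC [C0 CC] nCx.
pose p z := inf [set `|z - c| | c in C].
have lbp z : has_lbound [set `|z - c| | c in C] by exists 0 => _ [c _ <-].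
have ple z c : C c -> p z <= `|z - c|.
  by move=> Cc; apply: ge_inf => //; exists c.
have pS : sublinear p.
  apply: sublinear_inf => //; first by exists 0.
  move=> c d a b y z Cc Cd a0 b0; exists (a *: c + b *: d); first exact: CC.
  rewrite opprD addrACA -!scalerBr (le_trans (ler_normD _ _))// !normrZ.
  by rewrite !ger0_norm.
have px : 0 < p x.
  apply: contrapT => /negP; rewrite -leNgt => px; apply: nCx.
  apply: closed_approx => // e e0; have : p x < e by exact: le_lt_trans px e0.
  have ne : [set `|x - c| | c in C] !=set0 by exists `|x - 0|, 0.
  by move=> /(inf_lt ne) [_ [c Cc <-] /ltW]; exists c.
have [f [fp fx]] := hahn_banach x pS.
have fb z : f z <= `|z|.
  by apply: le_trans (fp z) _; rewrite -[z in leRHS]subr0; exact: ple.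
have [|z|phi phiE] := @bounded_linear_map _ X R^o (fun z => - f z) 1.
- by move=> a u v; rewrite linearP opprD scalerN.
- by rewrite mul1r normrN ler_norml fb andbT lerNl -linearN -(normrN z) fb.
exists phi; rewrite phiE; split => [c Cc|].
  rewrite oppr_ge0; apply: le_trans (fp c) _.
  by apply: le_trans (ple c c Cc) _; rewrite subrr normr0.
by rewrite fx oppr_lt0.
Qed.

End approximation.

(** * Finite nets *)

Lemma exprn_small (R : realType) (q e : R) :
  0 <= q -> q < 1 -> 0 < e -> exists n, q ^+ n <= e.
Proof.
move=> q0 q1 e0; have /cvg_expr/cvgr0Pnorm_le/(_ _ e0) : `|q| < 1.
  by rewrite ger0_norm.
by move=> [n _ /(_ n (leqnn n))] /=; rewrite ger0_norm ?exprn_ge0//; exists n.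
Qed.

Lemma ultra_pigeonhole (C : eqType) (I : Type) (U : set_system I)
    (B : C -> set I) (s : seq C) : UltraFilter U ->
  U (fun i => exists2 c, c \in s & B c i) ->
  exists2 c, c \in s & U (B c).
Proof.
move=> UU; elim: s => [|c s IHs] Us.
  have : U set0 by apply: filterS Us => i [].
  by move=> /filter_not_empty.
have [Bc|nBc] := in_ultra_setVsetC (B c) UU.
  by exists c; rewrite ?mem_head.
have [d ds Bd] : exists2 d, d \in s & U (B d).
  apply: IHs; apply: filterS (filterI Us nBc) => i [[d + Bd] nB].
  by rewrite in_cons => /orP[/eqP dc|ds]; [rewrite dc in Bd|exists d].
by exists d => //; rewrite in_cons ds orbT.
Qed.

Section finite_nets.
Context (R : realType) (X : completeNormedModType R).

(** The measure of noncompactness of A is at most r. *)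
Definition finite_net (A : set X) (r : R) :=
  exists s : seq X, forall x, A x -> exists2 c, c \in s & `|x - c| <= r.

Lemma finite_netS (A B : set X) (r r' : R) :
  A `<=` B -> r <= r' -> finite_net B r -> finite_net A r'.
Proof.
move=> AB rr [s sB]; exists s => x /AB/sB[c cs xc]; exists c => //.
exact: le_trans xc rr.
Qed.

Lemma precompact_net (A : set X) (r : R) :
  0 < r -> precompact A -> finite_net A r.
Proof.
move=> r0; rewrite precompactE compact_cover.
move=> /(_ X setT (fun c => ball c r)) [||D _ AD].
- by move=> c _; exact: ball_open.
- by move=> x _; exists x => //; exact: ballxx.
- exists (finmap.enum_fset D) => x /(@subset_closure _ A)/AD [c /= cD].
  by rewrite -ball_normE /= => /ltW xc; exists c => //; rewrite distrC.
Qed.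

(** An ultrafilter selects a single point of every finite net, so it is
    Cauchy. *)
Lemma ultra_net_cvg (I : Type) (U : set_system I) (f : I -> X) :
  UltraFilter U ->
  (forall e : R, 0 < e -> exists2 A, U A & finite_net (f @` A) e) ->
  cvg (f @ U).
Proof.
move=> UU netU; apply: cauchy_cvg; apply/cauchyP => e e0.
have [A UA [s sA]] := netU (e / 2) (divr_gt0 e0 (ltr0Sn _ _)).
have [|c _ Uc] := @ultra_pigeonhole X I U (fun c i => `|f i - c| <= e / 2) s UU.
  by apply: filterS UA => i Ai; apply: sA; exists i.
exists c; rewrite -[_ (ball c e)]/(U [set i | ball c e (f i)]).
apply: filterS Uc => i /= ic; rewrite -ball_normE /= distrC.
by apply: le_lt_trans ic _; lra.
Qed.

End finite_nets.

Section quasi_compact_nets.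
Context (R : realType) (X : completeNormedModType R).

Lemma compact_operator_bound (K : {linear X -> X}) : compact_operator K ->
  exists C, forall x, `|x| <= 1 -> `|K x| <= C.
Proof.
move=> /(precompact_net ltr01) [s sK]; exists (\sum_(c <- s) `|c| + 1) => x x1.
have [|c cs Kc] := sK (K x); first by exists x.
rewrite -[K x](subrK c) (le_trans (ler_normD _ _))// addrC lerD//.
rewrite (big_rem c)//= lerDl; exact: sumr_ge0.
Qed.

(** If A is within q of a compact operator, then A multiplies the measure of
    noncompactness by at most q; the extra d is the price of replacing the
    compact operator by a finite net. *)
Lemma finite_net_step (A K : {linear X -> X}) (B : set X) (q d r : R) :
  0 < d -> 0 < r -> compact_operator K ->
  (forall x, `|A x - K x| <= q * `|x|) -> 0 <= q ->
  finite_net B r -> finite_net (A @` B) (r * (q + d)).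
Proof.
move=> d0 r0 /(precompact_net d0) [sK KK] AK q0 [s sB].
exists [seq A c + r *: k | c <- s, k <- sK] => _ [x Bx <-].
have [c cs xc] := sB x Bx; pose b := r^-1 *: (x - c).
have b1 : `|b| <= 1.
  by rewrite normrZ gtr0_norm ?invr_gt0// ler_pdivrMl// mulr1.
have xE : x = c + r *: b by rewrite scalerA divff ?gt_eqF// scale1r subrKC.
have [|k ks Kk] := KK (K b); first by exists b.
exists (A c + r *: k); first exact: (allpairs_f (fun c k => A c + r *: k)).
rewrite {1}xE linearD linearZ /= opprD addrACA subrr add0r -scalerBr normrZ.
rewrite gtr0_norm// ler_pM2l// -[A b](subrK (K b)) -addrA.
rewrite (le_trans (ler_normD _ _))// lerD//.
by apply: le_trans (AK b) _; rewrite ler_piMr.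
Qed.

End quasi_compact_nets.

(** * Limit operators of a bounded semigroup *)

(** What the discrete and the continuous time axis have in common. *)
Record time_set (R : realType) (J : set R) : Prop := TimeSet {
  time0 : J 0 ;
  time_ge0 : forall t, J t -> 0 <= t ;
  timeD : forall s t, J s -> J t -> J (s + t) ;
  timeB : forall s t, J s -> J t -> s <= t -> J (t - s) ;
  time_unbounded : forall a, exists2 t, J t & a <= t }.

Lemma time_setP (R : realType) (J : set R) :
  J = range (fun n : nat => n%:R : R) \/ J = [set` `[0, +oo[] -> time_set J.
Proof.
case=> ->; split.
- by exists 0.
- by move=> _ [n _ <-].
- by move=> _ _ [n _ <-] [m _ <-]; exists (n + m)%N => //; rewrite natrD.
- move=> _ _ [n _ <-] [m _ <-]; rewrite ler_nat => nm.
  by exists (m - n)%N; rewrite ?natrB.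
- move=> a; exists (Num.truncn a).+1%:R; first by exists (Num.truncn a).+1.
  exact/ltW/truncnS_gt.
- by rewrite /= in_itv/= lexx.
- by move=> t /=; rewrite in_itv/= andbT.
- by move=> s t /=; rewrite !in_itv/= !andbT; exact: addr_ge0.
- by move=> s t /=; rewrite !in_itv/= !andbT subr_ge0.
- by move=> a; exists (`|a|); rewrite /= ?in_itv/= ?andbT// ler_norm.
Qed.

Section semigroup_limits.
Context (R : realType) (X : completeNormedModType R) (J : set R).
Context (T : R -> 'L(X)).
Context (M : R) (HJ : time_set J) (M0 : 0 < M).
Context (TM : forall t x, J t -> `|T t x| <= M * `|x|).
Context (T0 : forall x, T 0 x = x).
Context (TD : forall s t x, J s -> J t -> T (t + s) x = T t (T s x)).

Definition tail (t0 : R) : set X :=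
  [set y | exists t x, [/\ J t, t0 <= t, `|x| <= 1 & y = T t x]].

(** The measure of noncompactness of the union of all [T t] applied to the unit
    ball over [t >= t0] tends to 0 as [t0] grows. *)
Definition asymptotically_compact :=
  forall e, 0 < e -> exists2 t0, J t0 & finite_net (tail t0) e.

Lemma time_mulrn t n : J t -> J (t *+ n).
Proof.
move=> Jt; elim: n => [|n IHn]; first by rewrite mulr0n; exact: time0.
by rewrite mulrS; exact: timeD.
Qed.

Lemma iter_semigroup t n x : J t -> iter n (T t) x = T (t *+ n) x.
Proof.
move=> Jt; elim: n => [|n IHn] /=; first by rewrite mulr0n T0.
by rewrite IHn mulrS TD//; exact: time_mulrn.
Qed.

(** A net for one operator serves for all later times, because
    T_u = T_t T_(u - t) and T_(u - t) maps the unit ball into M times itself. *)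
Lemma tail_net t e : 0 < e -> J t ->
  finite_net [set T t x | x in [set x | `|x| <= 1]] e ->
  finite_net (tail t) (M * e).
Proof.
move=> e0 Jt [s sT]; exists [seq M *: c | c <- s] => _ [u [x [Ju tu x1 ->]]].
pose b := M^-1 *: T (u - t) x.
have b1 : `|b| <= 1.
  rewrite normrZ gtr0_norm ?invr_gt0// ler_pdivrMl// (le_trans (TM _ _))//.
    exact: timeB.
  by rewrite ler_pM2l.
have [|c cs bc] := sT (T t b); first by exists b.
exists (M *: c); first exact: map_f.
have -> : T u x = M *: T t b.
  rewrite linearZ/= scalerA divff ?gt_eqF// scale1r -TD//; last exact: timeB.
  by rewrite addrC subrK.
by rewrite -scalerBr normrZ gtr0_norm// ler_pM2l.
Qed.

Lemma quasi_compact_asymptotically_compact tau :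
  J tau -> quasi_compact (T tau) -> asymptotically_compact.
Proof.
move=> Jtau [m [K [_ Kc q1]]] e e0; set q := opnorm _ in q1.
have q0 : 0 <= q by exact: opnorm_ge0.
pose t := tau *+ m; have Jt : J t by exact: time_mulrn.
have [C KC] := compact_operator_bound Kc.
have TK x : `|T t x - K x| <= q * `|x|.
  have -> : T t x - K x = (T t \- K) x by [].
  have -> : q = opnorm (T t \- K).
    by congr opnorm; apply/funext => y /=; rewrite iter_semigroup.
  apply: (@le_opnorm _ _ _ _ (M + C)) => y y1 /=.
  rewrite (le_trans (ler_normB _ _))// lerD ?KC// (le_trans (TM _ _))//.
  by rewrite ler_piMr// ltW.
(* any number strictly between q and 1: the slack absorbs the finite nets *)
pose q' := q + (1 - q) / 2.
have [q'0 q'1] : 0 < q' /\ q' < 1 by rewrite /q'; lra.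
have netn n :
    finite_net [set T (t *+ n) x | x in [set x | `|x| <= 1]] (q' ^+ n).
  elim: n => [|n IHn].
    exists [:: 0] => _ [x x1 <-]; exists 0; rewrite ?mem_head//.
    by rewrite subr0 mulr0n T0 expr0.
  have -> : [set T (t *+ n.+1) x | x in [set x | `|x| <= 1]] =
      T t @` [set T (t *+ n) x | x in [set x | `|x| <= 1]].
    rewrite image_comp; congr (_ @` _); apply/funext => x /=.
    by rewrite mulrS TD//; exact: time_mulrn.
  rewrite exprSr; apply: finite_net_step TK _ IHn => //; first by lra.
  exact: exprn_gt0.
have [n qn] := exprn_small (ltW q'0) q'1 (divr_gt0 e0 M0).
exists (t *+ n); first exact: time_mulrn.
apply: finite_netS (tail_net _ (time_mulrn n Jt) (netn n));
  rewrite ?exprn_gt0//.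
by rewrite -ler_pdivlMl// mulrC.
Qed.

(** E lies in the closure of every tail of the semigroup for the strong operator
    topology, of which the finite lists of vectors give the basic
    neighbourhoods. *)
Definition strong_limit (E : X -> X) := forall (s : seq X) (e t0 : R), 0 < e ->
  exists t, [/\ J t, t0 <= t & forall x, x \in s -> `|E x - T t x| <= e].

(** At arbitrarily late times the semigroup is close to the identity
    simultaneously on any finitely many points of Y. *)
Definition recurrent (Y : set X) := forall (s : seq X) (e t0 : R), 0 < e ->
  (forall y, y \in s -> Y y) ->
  exists t, [/\ J t, t0 <= t & forall y, y \in s -> `|y - T t y| <= e].

Context (TC : asymptotically_compact).

Lemma recurrent_ultrafilter (Y : set X) : recurrent Y ->
  exists U : set_system R, [/\ UltraFilter U,
    forall t0, U [set t | J t /\ t0 <= t] &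
    forall y e, Y y -> 0 < e -> U [set t | `|y - T t y| <= e]].
Proof.
move=> YR; pose D (s : seq X) (e t0 : R) :=
  [set t | [/\ J t, t0 <= t & forall y, y \in s -> `|y - T t y| <= e]].
pose F : set_system R := [set A | exists (s : seq X) (e t0 : R),
  [/\ 0 < e, forall y, y \in s -> Y y & D s e t0 `<=` A]].
have FF : ProperFilter F.
  apply: Build_ProperFilter_ex.
    move=> A [s [e [t0 [e0 sY DA]]]]; have [t Dt] := YR s e t0 e0 sY.
    by exists t; exact: DA.
  split.
  - by exists [::], 1, 0; split.
  - move=> A B [s [e [t [e0 sY DA]]]] [s' [e' [t' [e'0 s'Y DB]]]].
    exists (s ++ s'), (Num.min e e'), (Num.max t t'); split.
    + by rewrite lt_min e0.
    + by move=> y; rewrite mem_cat => /orP[/sY|/s'Y].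
    + move=> u [Ju]; rewrite ge_max => /andP[tu t'u] uy; split.
        apply: DA; split=> // y ys; have := uy y; rewrite mem_cat ys le_min.
        by move=> /(_ isT)/andP[].
      apply: DB; split=> // y ys; have := uy y; rewrite mem_cat ys orbT le_min.
      by move=> /(_ isT)/andP[].
  - by move=> A B AB [s [e [t [e0 sY DA]]]]; exists s, e, t; split=> // u /DA/AB.
have [U [UU FU]] := ultraFilterLemma FF; exists U; split=> //.
- by move=> t0; apply: FU; exists [::], 1, t0; split=> // t [].
- move=> y e Yy e0; apply: FU; exists [:: y], e, 0; split=> //.
    by move=> z; rewrite inE => /eqP ->.
  by move=> t [_ _] /(_ y); rewrite mem_head => /(_ isT).
Qed.

Lemma ultra_strong_limit (U : set_system R) : UltraFilter U ->
  (forall t0, U [set t | J t /\ t0 <= t]) ->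
  exists E : 'L(X), forall x, T t x @[t --> U] --> E x.
Proof.
move=> UU Uoo.
have Tcvg x : cvg (T t x @[t --> U]).
  apply: ultra_net_cvg => e e0.
  have r0 : 0 < `|x| + 1 by rewrite ltr_wpDl.
  have [t0 Jt0 [s sT]] := TC (divr_gt0 e0 r0).
  exists [set t | J t /\ t0 <= t] => //.
  exists [seq (`|x| + 1) *: c | c <- s] => _ [t [Jt tt] <-].
  pose b := (`|x| + 1)^-1 *: x.
  have xb : x = (`|x| + 1) *: b by rewrite scalerA divff ?gt_eqF// scale1r.
  have [|c cs bc] := sT (T t b).
    exists t, b; split=> //.
    by rewrite normrZ normfV gtr0_norm// ler_pdivrMl// mulr1 lerDl.
  exists ((`|x| + 1) *: c); first exact: map_f.
  rewrite {1}xb linearZ/= -scalerBr normrZ gtr0_norm// -ler_pdivlMl//.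
  by rewrite mulrC.
pose E x := lim (T t x @[t --> U]).
have Ec x : T t x @[t --> U] --> E x by exact: Tcvg.
have El : linear E.
  move=> a x y; apply: cvg_lim => //.
  have -> : (fun t => T t (a *: x + y)) = (fun t => a *: T t x + T t y).
    by apply/funext => t; rewrite linearP.
  by apply: cvgD => //; exact: cvgZl_tmp.
have [|x|E' E'E] := @bounded_linear_map _ X X E M => //.
- apply/ler_addgt0Pr => e e0.
  have /(_ e e0)Ux : forall e, 0 < e -> U [set t | `|E x - T t x| <= e].
    by move=> d d0; have /cvgrPdist_le/(_ d d0) := Ec x.
  have [t [+ [Jt _]]] := filter_ex (filterI Ux (Uoo 0)).
  rewrite /= -{2}[E x](subrK (T t x)) => xt.
  by rewrite (le_trans (ler_normD _ _))// addrC lerD// TM.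
- by exists E'; rewrite E'E.
Qed.

(** For [Y = set0] this merely produces some limit operator; for the range of a
    limit operator S it produces one with E S = S. *)
Lemma recurrent_strong_limit (Y : set X) : recurrent Y ->
  exists E : 'L(X), strong_limit E /\ forall y, Y y -> E y = y.
Proof.
move=> /recurrent_ultrafilter [U [UU Uoo UY]].
have [E Ec] := ultra_strong_limit UU Uoo; exists E.
have UE x e : 0 < e -> U [set t | `|E x - T t x| <= e].
  by move=> e0; have /cvgrPdist_le/(_ e e0) := Ec x.
split=> [s e t0 e0|y Yy].
  have [t [[Jt tt] ts]] : exists t, (J t /\ t0 <= t) /\
      forall x, x \in s -> `|E x - T t x| <= e.
    apply: (@filter_ex _ U); apply: filterI; first exact: Uoo.
    elim: s => [|x s IHs]; first by apply: filterS filterT.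
    apply: filterS (filterI (UE x e e0) IHs) => t [xt st] z.
    by rewrite in_cons => /orP[/eqP ->|/st].
  by exists t.
apply/eqP; rewrite -subr_eq0 -normr_le0; apply/ler_addgt0Pr => e e0; rewrite add0r.
have e2 : 0 < e / 2 by rewrite divr_gt0.
have [t [+ +]] := filter_ex (filterI (UE y _ e2) (UY y _ Yy e2)).
rewrite /= => Et yt; rewrite -(subrKA (T t y)) (le_trans (ler_normD _ _))//.
by rewrite [e]splitr lerD// distrC.
Qed.

Section properties.
Context (E : 'L(X)) (EL : strong_limit E).

Lemma strong_limit_bound x : `|E x| <= M * `|x|.
Proof.
apply/ler_addgt0Pr => e e0; have [t [Jt _ /(_ x)]] := EL [:: x] 0 e0.
rewrite mem_head => /(_ isT) xt; rewrite -[E x](subrK (T t x)).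
by rewrite (le_trans (ler_normD _ _))// addrC lerD// TM.
Qed.

Lemma semigroup_comm s t x : J s -> J t -> T s (T t x) = T t (T s x).
Proof. by move=> Js Jt; rewrite -!TD// addrC. Qed.

Lemma strong_limit_comm t x : J t -> E (T t x) = T t (E x).
Proof.
move=> Jt; apply/eqP; rewrite -subr_eq0 -normr_le0.
apply/ler_addgt0Pr => e e0; rewrite add0r.
have d0 : 0 < e / (1 + M) by rewrite divr_gt0// addr_gt0.
have [s [Js _ sP]] := EL [:: x; T t x] 0 d0.
have := sP (T t x); rewrite !inE eqxx orbT => /(_ isT) h1.
have := sP x; rewrite !inE eqxx => /(_ isT) h2.
have h3 : `|T t (T s x) - T t (E x)| <= M * (e / (1 + M)).
  by rewrite -linearB (le_trans (TM _ Jt))// ler_pM2l// distrC.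
rewrite -(subrKA (T s (T t x))) (le_trans (ler_normD _ _))//.
rewrite {2}semigroup_comm// (le_trans (lerD h1 h3))//.
by rewrite -{1}[e / (1 + M)]mul1r -mulrDl mulrC divfK// gt_eqF// addr_gt0.
Qed.

Lemma strong_limit_closed (P : set X) x : closed P ->
  (forall t, J t -> P (T t x)) -> P (E x).
Proof.
move=> cP PT; apply: closed_approx => // e e0.
have [t [Jt _ /(_ x)]] := EL [:: x] 0 e0; rewrite mem_head => /(_ isT) xt.
by exists (T t x) => //; exact: PT.
Qed.

Definition stable x := forall e, 0 < e ->
  exists t0, forall t, J t -> t0 <= t -> `|T t x| <= e.

(** By boundedness an orbit that comes close to 0 once stays close to 0, so all
    limit operators have the same kernel. *)
Lemma strong_limit_ker x : E x = 0 <-> stable x.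
Proof.
split=> [Ex e e0|Sx].
  have [t [Jt _ /(_ x)]] := EL [:: x] 0 (divr_gt0 e0 M0).
  rewrite mem_head Ex sub0r normrN => /(_ isT) tx; exists t => u Ju tu.
  rewrite -(subrKC t u) addrC TD//; last exact: timeB.
  by rewrite (le_trans (TM _ (timeB HJ Jt Ju tu)))// mulrC -ler_pdivlMr.
apply/eqP; rewrite -normr_le0; apply/ler_addgt0Pr => e e0; rewrite add0r.
have e2 : 0 < e / 2 by rewrite divr_gt0.
have [t0 xt0] := Sx _ e2.
have [t [Jt tt /(_ x)]] := EL [:: x] t0 e2; rewrite mem_head => /(_ isT) xt.
rewrite -[E x](subrK (T t x)) (le_trans (ler_normD _ _))//.
by rewrite [e]splitr lerD// xt0.
Qed.

Lemma strong_limit_net e : 0 < e -> finite_net (E @` [set x | `|x| <= 1]) e.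
Proof.
move=> e0; have e2 : 0 < e / 2 by rewrite divr_gt0.
have [t0 _ [s sT]] := TC e2; exists s => _ [x x1 <-].
have [t [Jt tt /(_ x)]] := EL [:: x] t0 e2; rewrite mem_head => /(_ isT) xt.
have [|c cs tc] := sT (T t x); first by exists t, x.
exists c => //; rewrite -(subrKA (T t x)) (le_trans (ler_normD _ _))//.
by rewrite [e]splitr lerD.
Qed.

(** If [T t1 x] and [T t2 x] are both close to [E x], then [T (t2 - t1)] nearly
    fixes [E x]. *)
Lemma strong_limit_recurrent : recurrent (range E).
Proof.
move=> s e t0 e0 sE.
have /choice [g gE] : forall y, exists x, range E y -> E x = y.
  by move=> y; have [[x _ <-]|nE] := pselect (range E y); [exists x|exists 0].
have d0 : 0 < e / (1 + M) by rewrite divr_gt0// addr_gt0.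
have [t1 [Jt1 _ t1s]] := EL [seq g y | y <- s] 0 d0.
have [t2 [Jt2 t12 t2s]] := EL [seq g y | y <- s] (t1 + Num.max 0 t0) d0.
have le12 : t1 <= t2 by apply: le_trans t12; rewrite lerDl le_max lexx.
exists (t2 - t1); split; first exact: timeB.
  rewrite lerBrDl; apply: le_trans t12; rewrite lerD2l.
  by rewrite le_max lexx orbT.
move=> y ys; have Eg := gE y (sE y ys).
have := t1s (g y) (map_f g ys); have := t2s (g y) (map_f g ys).
rewrite Eg => h2 h1.
have T21 : T t2 (g y) = T (t2 - t1) (T t1 (g y)).
  by rewrite -TD ?subrK//; exact: timeB.
rewrite T21 in h2.
have h3 : `|T (t2 - t1) (T t1 (g y)) - T (t2 - t1) y| <= M * (e / (1 + M)).
  rewrite -linearB (le_trans (TM _ (timeB HJ Jt1 Jt2 le12)))//.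
  by rewrite ler_pM2l// distrC.
rewrite -(subrKA (T (t2 - t1) (T t1 (g y)))) (le_trans (ler_normD _ _))//.
rewrite (le_trans (lerD h2 h3))//.
by rewrite -{1}[e / (1 + M)]mul1r -mulrDl mulrC divfK// gt_eqF// addr_gt0.
Qed.

End properties.

(** With E S = S and S E = E S one gets S (x - E x) = 0; as S and E have the
    same kernel, E (x - E x) = 0. *)
Lemma limit_projection :
  exists E : 'L(X), strong_limit E /\ forall x, E (E x) = E x.
Proof.
have [|S [SL _]] := @recurrent_strong_limit set0.
  move=> s e t0 e0 s0; have [t Jt tt] := time_unbounded HJ t0.
  by exists t; split=> // y /s0.
have [E [EL ES]] := recurrent_strong_limit (strong_limit_recurrent SL).
exists E; split=> // x.
have SE : S (E x) = S x.
  rewrite -(ES (S x)); last by exists x.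
  apply/eqP; rewrite -subr_eq0 -normr_le0.
  apply/ler_addgt0Pr => e e0; rewrite add0r.
  have d0 : 0 < e / (1 + M) by rewrite divr_gt0// addr_gt0.
  have [s [Js _ sP]] := EL [:: x; S x] _ 0 d0.
  have := sP (S x); rewrite !inE eqxx orbT => /(_ isT) h1.
  have := sP x; rewrite !inE eqxx => /(_ isT) h2.
  have h3 : `|S (E x) - T s (S x)| <= M * (e / (1 + M)).
    rewrite -strong_limit_comm// -linearB (le_trans (strong_limit_bound SL _))//.
    by rewrite ler_pM2l.
  rewrite -(subrKA (T s (S x))) (le_trans (ler_normD _ _))//.
  rewrite distrC in h1; rewrite (le_trans (lerD h3 h1))//.
  by rewrite -{2}[e / (1 + M)]mul1r -mulrDl addrC mulrC divfK// gt_eqF// addr_gt0.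
have /(strong_limit_ker SL)/(strong_limit_ker EL)/eqP : S (x - E x) = 0.
  by rewrite linearB/= SE subrr.
by rewrite linearB/= subr_eq0 eq_sym => /eqP.
Qed.

End semigroup_limits.

(** * Almost interior points *)

Section cones.
Context (R : realType) (X : completeNormedModType R).

Context (P : set X) (HP : positive_cone P).

Lemma cone0 : P 0.
Proof.
have [x Px] := cone_nonempty HP.
by have := cone_combination HP (lexx 0) (lexx 0) Px Px; rewrite !scale0r addr0.
Qed.

Lemma coneZ (a : R) x : 0 <= a -> P x -> P (a *: x).
Proof.
move=> a0 Px; have := cone_combination HP a0 (lexx 0) Px cone0.
by rewrite scaler0 addr0.
Qed.

Lemma coneD x y : P x -> P y -> P (x + y).
Proof.
by move=> Px Py; have := cone_combination HP ler01 ler01 Px Py; rewrite !scale1r.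
Qed.

Lemma cone_anti x : P x -> P (- x) -> x = 0.
Proof.
move=> Px Pnx; have : (P `&` [set - x | x in P]) x.
  by split=> //; exists (- x) => //; rewrite opprK.
by rewrite (cone_pointed HP).
Qed.

(** The cone P - R_+ v is dense: a functional separating a point from its
    closure would be positive on P, nonzero, and at most 0 at v. *)
Lemma almost_interior_dense v x (e : R) : almost_interior P v -> 0 < e ->
  exists p L, [/\ P p, 0 <= L & `|x - (p - L *: v)| <= e].
Proof.
move=> vi e0.
pose D : set X := [set y | exists p (L : R), [/\ P p, 0 <= L & y = p - L *: v]].
have DP p : P p -> D p by move=> Pp; exists p, 0; rewrite scale0r subr0.
have DC : convex_cone D.
  split; first exact/DP/cone0.
  move=> a b _ _ a0 b0 [p [L [Pp L0 ->]]] [q [N [Pq N0 ->]]].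
  exists (a *: p + b *: q), (a * L + b * N); split.
  - exact: (cone_combination HP).
  - by rewrite addr_ge0// mulr_ge0.
  - by rewrite !scalerBr !scalerA addrACA -opprD -scalerDl.
suff /closure_approx/(_ e0)[_ [p [L [Pp L0 ->]]] xe] : closure D x by exists p, L.
apply: contrapT => nDx.
have [phi [phi0 phix]] :=
  cone_separation (@closed_closure _ D) (convex_cone_closure DC) nDx.
have phiv : 0 < phi v.
  apply: vi => [p Pp|phiE]; first exact/phi0/subset_closure/DP.
  by rewrite phiE ltxx in phix.
have : 0 <= phi (- v).
  apply/phi0/subset_closure; exists 0, 1; split=> //; first exact: cone0.
  by rewrite scale1r sub0r.
by rewrite linearN oppr_ge0 leNgt phiv.
Qed.

(** Finitely many points can share the multiple L, since it may be increased at
    the expense of p. *)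
Lemma almost_interior_dense_seq v (s : seq X) (e : R) : P v ->
  almost_interior P v -> 0 < e -> exists2 L, 0 <= L &
    forall c, c \in s -> exists2 p, P p & `|c - (p - L *: v)| <= e.
Proof.
move=> Pv vi e0; elim: s => [|c s [L L0 IHs]]; first by exists 0.
have [p [N [Pp N0 cp]]] := almost_interior_dense c vi e0.
exists (Num.max L N) => [|d]; first by rewrite le_max L0.
have shift q K : P q -> K <= Num.max L N ->
    exists2 q', P q' & q' - Num.max L N *: v = q - K *: v.
  move=> Pq KL; exists (q + (Num.max L N - K) *: v).
    by apply: coneD => //; apply: coneZ => //; rewrite subr_ge0.
  by rewrite scalerBl addrA addrAC addrK.
rewrite in_cons => /orP[/eqP ->|/IHs[q Pq dq]].
  have [|q Pq qE] := @shift p N Pp; first by rewrite le_max lexx orbT.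
  by exists q => //; rewrite qE.
have [|q' Pq' qE] := @shift q L Pq; first by rewrite le_max lexx.
by exists q' => //; rewrite qE.
Qed.

(** On the range of a compact projection an almost interior point is an order
    unit.  A dense cone need not be everything, but compactness gives one
    multiple L with which every y of the range is approximated by P - L |y| v up
    to the error |y| / 2; repeating this on the error, the multiples add up to
    a geometric series, and closedness of P removes the error. *)
Lemma almost_interior_absorbs (E : 'L(X)) v :
  (forall x, E (E x) = E x) -> (forall p, P p -> P (E p)) ->
  (forall e, 0 < e -> finite_net (E @` [set x | `|x| <= 1]) e) ->
  P v -> E v = v -> almost_interior P v ->
  forall x, E x = x -> exists2 L, 0 <= L & P (x + L *: v).
Proof.
move=> EE EP Enet Pv Ev vi x Ex.
have [M M0 EM] := bounded_linear_bound E.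
(* both the net and the approximation of its points contribute d, and E
   multiplies the error by M: 2 * d * M = 1 / 2 *)
pose d := (4 * M)^-1; have d0 : 0 < d by rewrite invr_gt0 mulr_gt0.
have [s sE] := Enet d d0.
have [L L0 sL] := almost_interior_dense_seq s Pv vi d0.
have halve r y : 0 < r -> E y = y -> `|y| <= r ->
    exists p, [/\ P p, E p = p & `|y - p + (r * L) *: v| <= r / 2].
  move=> r0 Ey yr; have [|c cs yc] := sE (r^-1 *: y).
    exists (r^-1 *: y) => /=; last by rewrite linearZ/= Ey.
    by rewrite normrZ gtr0_norm ?invr_gt0// ler_pdivrMl// mulr1.
  have [p Pp cp] := sL c cs; exists (r *: E p); split.
  - by apply: coneZ; [exact: ltW|exact: EP].
  - by rewrite linearZ/= EE.
  have -> : y - r *: E p + (r * L) *: v = r *: E (r^-1 *: y - (p - L *: v)).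
    have -> : E (r^-1 *: y - (p - L *: v)) = r^-1 *: y - (E p - L *: v).
      by rewrite !linearB !linearZ/= Ey Ev.
    rewrite scalerBr scalerA divff ?gt_eqF// scale1r.
    by rewrite scalerBr opprB scalerA addrA addrAC.
  rewrite normrZ gtr0_norm// ler_pM2l// (le_trans (EM _))//.
  rewrite -ler_pdivlMl//; apply: (@le_trans _ _ (d + d)).
    by rewrite -(subrKA c) (le_trans (ler_normD _ _))// lerD.
  by rewrite /d invfM; lra.
have approx n : forall r y, 0 < r -> E y = y -> `|y| <= r ->
    exists2 p, P p & `|y + (2 * L * r) *: v - p| <=
      (1 + 2 * L * `|v|) * r * 2^-1 ^+ n.
  elim: n => [|n IHn] r y r0 Ey yr.
    exists 0; first exact: cone0.
    have -> : (1 + 2 * L * `|v|) * r * 2^-1 ^+ 0 = r + 2 * L * r * `|v|.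
      by rewrite expr0; ring.
    rewrite subr0 (le_trans (ler_normD _ _))// lerD//.
    by rewrite normrZ ger0_norm ?mulr_ge0// ltW.
  have [p [Pp Ep yp]] := halve r y r0 Ey yr.
  have [||p' Pp' yp'] := IHn (r / 2) (y - p + (r * L) *: v) _ _ yp.
  - by rewrite divr_gt0.
  - by rewrite linearD linearB linearZ/= Ey Ep Ev.
  exists (p + p'); first exact: coneD.
  have -> : y + (2 * L * r) *: v - (p + p') =
      y - p + (r * L) *: v + (2 * L * (r / 2)) *: v - p'.
    rewrite -[y - p + _ + _]addrA -scalerDl.
    have -> : r * L + 2 * L * (r / 2) = 2 * L * r by field.
    by rewrite opprD !addrA; congr (_ - _); rewrite addrAC.
  by apply: le_trans yp' _; rewrite exprS !mulrA.
have r0 : 0 < `|x| + 1 by rewrite ltr_wpDl.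
exists (2 * L * (`|x| + 1)); first by rewrite !mulr_ge0// ltW.
apply: closed_approx => [|e e0]; first exact: cone_closed HP.
pose K := (1 + 2 * L * `|v|) * (`|x| + 1).
have K0 : 0 < K by rewrite mulr_gt0// ltr_wpDr// !mulr_ge0.
have [|||n ne] := @exprn_small R 2^-1 (e / K); [by lra|by lra|exact: divr_gt0|].
have [|p Pp xp] := approx n _ x r0 Ex; first by rewrite lerDl.
by exists p => //; apply: le_trans xp _; rewrite -ler_pdivlMl// mulrC.
Qed.

End cones.

(** * The limit projection of an irreducible positive semigroup *)

Section limit_operator.
Context (R : realType) (X : completeNormedModType R) (J : set R).
Context (T : R -> 'L(X)).
Context (M : R) (HJ : time_set J) (M0 : 0 < M).
Context (TM : forall t x, J t -> `|T t x| <= M * `|x|).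
Context (T0 : forall x, T 0 x = x).
Context (TD : forall s t x, J s -> J t -> T (t + s) x = T t (T s x)).
Context (TC : asymptotically_compact J T).
Context (P : set X) (HP : positive_cone P).
Context (TP : forall t x, J t -> P x -> P (T t x)).
Context (TI : forall x, P x -> x <> 0 ->
  exists2 t, J t & almost_interior P (T t x)).
Context (E : 'L(X)) (EL : strong_limit J T E) (EE : forall x, E (E x) = E x).

Let ET t x : J t -> E (T t x) = T t (E x).
Proof. by move=> Jt; exact: (strong_limit_comm M0 TM TD EL). Qed.

Let EP x : P x -> P (E x).
Proof.
move=> Px; apply: (strong_limit_closed EL (cone_closed HP)) => t Jt.
exact: TP.
Qed.

(** A fixed point x of E is a limit of vectors T_s x = T_(s - t) (T_t x), which
    are positive as soon as T_t x is. *)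
Lemma positive_of_semigroup_positive t x :
  J t -> E x = x -> P (T t x) -> P x.
Proof.
move=> Jt Ex Ptx; apply: closed_approx => [|e e0]; first exact: cone_closed HP.
have [s [Js ts /(_ x)]] := EL [:: x] t e0; rewrite mem_head Ex => /(_ isT) xs.
exists (T s x) => //; rewrite -(subrK t s) TD//; last exact: timeB.
by apply: TP => //; exact: timeB.
Qed.

(** If E vanished on P, then for every functional phi the functional phi o E
    would be positive and vanish on P; as P contains almost interior points,
    it would be 0, and so would E by Hahn-Banach. *)
Lemma positive_fixed_vector : P <> [set 0] -> (E : X -> X) <> 0 ->
  exists u, [/\ P u, u <> 0 & E u = u].
Proof.
move=> Pn0 En0; apply: contrapT => nu.
have EP0 x : P x -> E x = 0.
  move=> Px; apply: contrapT => Ex0; apply: nu; exists (E x); split=> //.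
  exact: EP.
have [x0 Ex0] : exists x, E x <> 0.
  apply: contrapT => /forallNP E0; apply: En0; apply/funext => x.
  exact: (contrapT (E0 x)).
have [x Px xn0] : exists2 x, P x & x <> 0.
  apply: contrapT => /forall2NP P0; apply: Pn0; apply/seteqP; split=> x /=.
    by move=> Px; have [|/contrapT] := P0 x.
  by move=> ->; exact: cone0 HP.
have [|||phi [_ phix0]] := @cone_separation R X [set 0] (E x0).
- exact/accessible_closed_set1/hausdorff_accessible/norm_hausdorff.
- by split=> // a b y z _ _ -> ->; rewrite !scaler0 addr0.
- exact: Ex0.
have [t Jt Ti] := TI Px xn0.
suff : 0 < (phi \o E : boundedLinear X R^o) (T t x).
  by rewrite /= EP0 ?linear0 ?ltxx//; exact: TP.
apply: Ti => [y Py|phiE]; first by rewrite /= EP0// linear0.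
by have := congr1 (@^~ x0) phiE => /= phi0; rewrite phi0 ltxx in phix0.
Qed.

(** The supremum l of the numbers with u - l z in P is finite, as otherwise
    - z = lim (u - l z) / l would lie in P, and it is attained.  If u - l z were
    nonzero, some T_t would make it almost interior, hence able to absorb
    a further multiple of T_t z; recurrence pulls this back to u - (l + e) z in
    P. *)
Lemma fixed_collinear_half u z : P u -> u <> 0 -> E u = u -> E z = z ->
  ~ P (- z) -> exists a : R, z = a *: u.
Proof.
move=> Pu un0 Eu Ez nPz; pose A := [set l : R | 0 <= l /\ P (u - l *: z)].
have A0 : A 0 by split=> //; rewrite scale0r subr0.
have Asup : has_sup A.
  split; first by exists 0.
  apply: contrapT => nA; apply: nPz; apply: closed_approx => [|e e0].
    exact: cone_closed HP.
  have [l [l0 Pl] ul] : exists2 l, A l & `|u| / e < l.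
    apply: contrapT => /forall2NP ule; apply: nA; exists (`|u| / e) => l Al.
    by have [//|/negP] := ule l; rewrite -leNgt.
  have lp : 0 < l by apply: le_lt_trans ul; rewrite divr_ge0// ltW.
  exists (l^-1 *: (u - l *: z)).
    by apply: (coneZ HP) => //; rewrite invr_ge0.
  rewrite scalerBr scalerA mulVf ?gt_eqF// scale1r opprB addKr.
  rewrite normrN normrZ gtr0_norm ?invr_gt0// ler_pdivrMl//.
  by rewrite -ler_pdivrMr// ltW.
pose l := sup A; have lA m : A m -> m <= l.
  by move=> Am; apply: ub_le_sup => //; case: Asup.
have Al : A l.
  split; first exact: lA.
  apply: closed_approx => [|e e0]; first exact: cone_closed HP.
  have z0 : 0 < `|z| + 1 by rewrite ltr_wpDl.
  have [m Am lm] := sup_adherent (divr_gt0 e0 z0) Asup.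
  exists (u - m *: z); first by case: Am.
  rewrite opprB addrC subrKA -scalerBl normrZ distrC ger0_norm ?subr_ge0 ?lA//.
  apply: (@le_trans _ _ (e / (`|z| + 1) * `|z|)).
    by rewrite ler_wpM2r// lerBlDr addrC -lerBlDr ltW.
  by rewrite mulrAC ler_pdivrMr// ler_pM2l// lerDl.
pose w := u - l *: z; have [w0|wn0] := pselect (w = 0).
  have uE : u = l *: z by apply/eqP; rewrite -subr_eq0 -/w w0.
  have ln0 : l != 0 by apply/eqP => l0; apply: un0; rewrite uE l0 scale0r.
  by exists l^-1; rewrite uE scalerA mulVf// scale1r.
have [t Jt Ti] := TI Al.2 wn0.
have Ew : E w = w by rewrite linearB linearZ/= Eu Ez.
have [|||L L0 PL] := almost_interior_absorbs HP EE EP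
  (strong_limit_net TC EL) _ _ Ti (x := - T t z).
- exact/TP/Al.2.
- by rewrite ET// Ew.
- by rewrite linearN/= ET// Ez.
have L1 : 0 < L + 1 by rewrite ltr_wpDl.
suff : A (l + (L + 1)^-1) by move=> /lA; rewrite gerDl leNgt invr_gt0 L1.
split; first by rewrite addr_ge0 ?Al.1// invr_ge0 ltW.
apply: (positive_of_semigroup_positive Jt).
  by rewrite linearB linearZ/= Eu Ez.
have -> : u - (l + (L + 1)^-1) *: z = w - (L + 1)^-1 *: z.
  by rewrite scalerDl opprD addrA.
have -> : T t (w - (L + 1)^-1 *: z) =
    (L + 1)^-1 *: ((- T t z + L *: T t w) + T t w).
  rewrite linearB/= [T t (_ *: z)]linearZ/= -addrA.
  rewrite -[X in _ + (_ + X)]scale1r -scalerDl.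
  by rewrite scalerDr scalerA mulVf ?gt_eqF// scale1r scalerN addrC.
apply: (coneZ HP); first by rewrite invr_ge0 ltW.
by apply: (coneD HP) => //; exact/TP/Al.2.
Qed.

Lemma fixed_collinear u z : P u -> u <> 0 -> E u = u -> E z = z ->
  exists a : R, z = a *: u.
Proof.
move=> Pu un0 Eu Ez.
have [Pnz|nPz] := pselect (P (- z)); last exact: fixed_collinear_half.
have [Pz|nPz] := pselect (P z).
  by exists 0; rewrite scale0r; exact: (cone_anti HP).
have [||a za] := @fixed_collinear_half u (- z) Pu un0 Eu.
- by rewrite linearN/= Ez.
- by rewrite opprK.
- by exists (- a); rewrite scaleNr -za opprK.
Qed.

(** T_t u lies on the line of u, so T_t u = c u.  Growth (c > 1) contradicts
    boundedness, and decay (c < 1) puts u into the kernel of E. *)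
Lemma fixed_vector_invariant u t : P u -> u <> 0 -> E u = u -> J t -> T t u = u.
Proof.
move=> Pu un0 Eu Jt.
have [c Tc] : exists c : R, T t u = c *: u.
  by apply: fixed_collinear => //; rewrite ET// Eu.
have Tn n : T (t *+ n) u = c ^+ n *: u.
  rewrite -(iter_semigroup HJ T0 TD)//.
  elim: n => [|n IHn] /=; first by rewrite expr0 scale1r.
  by rewrite IHn linearZ/= Tc scalerA exprSr.
have un : 0 < `|u| by rewrite normr_gt0; exact/eqP.
have c0 : 0 <= c.
  rewrite leNgt; apply/negP => c0; apply: un0; apply: (cone_anti HP) => //.
  have -> : - u = (- c)^-1 *: T t u.
    by rewrite Tc scalerA invrN mulNr mulVf ?lt_eqF// scaleN1r.
  by apply: (coneZ HP); [rewrite invr_ge0 oppr_ge0 ltW|exact: TP].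
have c1 : ~ c < 1.
  move=> c1; apply: un0; rewrite -Eu.
  apply/(strong_limit_ker HJ M0 TM TD EL) => e e0.
  have [n cn] := exprn_small c0 c1 (divr_gt0 e0 (mulr_gt0 M0 un)).
  exists (t *+ n) => s Js ts; have Jtn := time_mulrn HJ n Jt.
  rewrite -(subrK (t *+ n) s) TD//; last exact: timeB.
  rewrite (le_trans (TM _ (timeB HJ Jtn Js ts)))// Tn normrZ.
  by rewrite ger0_norm ?exprn_ge0// mulrCA -ler_pdivlMr// mulr_gt0.
have c2 : ~ 1 < c.
  move=> c2; have cp : 0 < c by rewrite (lt_trans _ c2).
  have c3 : c^-1 < 1 by rewrite invf_lt1.
  have ci : 0 <= c^-1 by rewrite invr_ge0.
  have d0 : 0 < (2 * M)^-1 by rewrite invr_gt0 mulr_gt0.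
  have [n] := exprn_small ci c3 d0.
  rewrite exprVn lef_pV2 ?posrE ?exprn_gt0 ?mulr_gt0// leNgt => /negP; apply.
  have := TM u (time_mulrn HJ n Jt).
  rewrite Tn normrZ ger0_norm ?exprn_ge0// ler_pM2r// => cM.
  by apply: le_lt_trans cM _; rewrite ltr_pMl// ltr1n.
rewrite Tc; suff -> : c = 1 by rewrite scale1r.
by apply/eqP; rewrite eq_le !leNgt; apply/andP; split; exact/negP.
Qed.

(** With T_t E = E = E T_t one has T_t - E = (T_(t - t1) - E) T_t1.  The operator
    T_t1 nearly maps the unit ball into a finite set, on which T_s - E tends to
    0 uniformly. *)
Lemma stable_cvg_opnorm : (forall t x, J t -> T t (E x) = E x) ->
  cvg_opnorm J T E.
Proof.
move=> TE; apply/cvgrPdist_le => e e0.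
have M1 : 0 < 1 + 2 * M by rewrite addr_gt0// mulr_gt0.
have d0 : 0 < e / (1 + 2 * M) by rewrite divr_gt0.
set d := e / _ in d0.
have [t1 Jt1 [s sT]] := TC d0.
have St x : stable J T (x - E x).
  apply/(strong_limit_ker HJ M0 TM TD EL).
  by rewrite linearB/= EE subrr.
have [t2 t2s] : exists t2, forall c t, c \in s -> J t -> t2 <= t ->
    `|T t c - E c| <= d.
  elim: {sT} s => [|c s [t2 IHs]]; first by exists 0.
  have [t3 ct3] := St c _ d0; exists (Num.max t2 t3) => b t.
  rewrite in_cons ge_max => /orP[/eqP ->|bs] Jt /andP[tt2 tt3].
    by have := ct3 t Jt tt3; rewrite linearB/= TE.
  exact: IHs.
exists (t1 + Num.max 0 t2); split=> [|t /ltW tt Jt]; first exact: num_real.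
have t1t : t1 <= t by apply: le_trans tt; rewrite lerDl le_max lexx.
have t2t : t2 <= t - t1.
  by rewrite lerBrDl; apply: le_trans tt; rewrite lerD2l le_max lexx orbT.
have Jtt : J (t - t1) by exact: timeB.
rewrite /= sub0r normrN ger0_norm ?opnorm_ge0//; apply: opnorm_le => x x1 /=.
have [|c cs xc] := sT (T t1 x); first by exists t1, x.
have -> : T t x - E x =
    (T (t - t1) c - E c) + (T (t - t1) (T t1 x - c) - E (T t1 x - c)).
  rewrite addrACA -opprD -!linearD/= subrKC -TD// subrK.
  by rewrite ET// TE.
rewrite (le_trans (ler_normD _ _))//.
have -> : e = d + (M * d + M * d) by rewrite /d; field; exact: lt0r_neq0.
rewrite lerD//; first exact: t2s.
rewrite (le_trans (ler_normB _ _))// lerD//.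
  by rewrite (le_trans (TM _ Jtt))// ler_pM2l.
by rewrite (le_trans (strong_limit_bound TM EL _))// ler_pM2l.
Qed.

End limit_operator.

(** * Convergence of the semigroup *)

Lemma bounded_semigroup_bound (R : realType) (X : completeNormedModType R)
    (J : set R) (T : R -> 'L(X)) : bounded_semigroup J T ->
  exists2 M, 0 < M & forall t x, J t -> `|T t x| <= M * `|x|.
Proof.
move=> [C TC]; exists (`|C| + 1) => [|t x Jt]; first by rewrite ltr_wpDl.
have [B B0 TB] := bounded_linear_bound (T t).
apply: (@le_trans _ _ (opnorm (T t) * `|x|)).
  apply: (@le_opnorm _ _ _ _ B) => y y1.
  by rewrite (le_trans (TB y))// ler_piMr// ltW.
apply: ler_wpM2r => //; apply: (@le_trans _ _ C).
  by apply: TC; exists t.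
by rewrite (le_trans (ler_norm C))// lerDl.
Qed.

Theorem theorem5p3 (R : realType) (X : completeNormedModType R) (P : set X)
    (J : set R) (T : R -> 'L(X)) :
  positive_cone P -> P <> [set 0] ->
  J = range (fun n : nat => n%:R : R) \/ J = [set` `[0, +oo[] ->
  operator_semigroup J T -> positive_semigroup P J T ->
  (forall x, P x -> x <> 0 -> exists2 t, J t & almost_interior P (T t x)) ->
  bounded_semigroup J T -> (exists2 tau, J tau & quasi_compact (T tau)) ->
  exists2 Q : 'L(X), cvg_opnorm J T Q &
    (Q : X -> X) <> 0 ->
    exists (y : X) (y' : dual X),
      [/\ Q = tensor y' y,
          almost_interior P y,
          (forall t, J t -> T t y = y),
          strictly_positive P y' &
          (forall t, J t -> dual_op (T t) y' = y')].
Proof.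
move=> HP Pn0 /time_setP HJ [semi0 semiD] posT TI.
move=> /bounded_semigroup_bound [M M0 TM] [tau Jtau qcT].
have T0 x : T 0 x = x by rewrite semi0.
have TD s t x : J s -> J t -> T (t + s) x = T t (T s x).
  by move=> Js Jt; rewrite semiD.
have TP t x : J t -> P x -> P (T t x).
  by move=> Jt Px; apply: (posT t Jt); exists x.
have TC := quasi_compact_asymptotically_compact HJ M0 TM T0 TD Jtau qcT.
have [E [EL EE]] := limit_projection HJ M0 TM TD TC.
have ET t x : J t -> E (T t x) = T t (E x).
  by move=> Jt; exact: (strong_limit_comm M0 TM TD EL).
have [E0|En0] := pselect ((E : X -> X) = 0).
  exists E => //; apply: (stable_cvg_opnorm HJ M0 TM TD TC EL EE) => t x Jt.
  by rewrite E0 linear0.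
have [u [Pu un0 Eu]] := positive_fixed_vector HP TP TI EL EE Pn0 En0.
have Tu t : J t -> T t u = u.
  exact: (fixed_vector_invariant HJ M0 TM T0 TD TC HP TP TI EL EE Pu un0 Eu).
have [y' Ey'] : exists y' : dual X, forall x, E x = y' x *: u.
  apply: (rank_one_functional un0) => x.
  exact: (fixed_collinear HJ M0 TM TD TC HP TP TI EL EE Pu un0 Eu (EE x)).
have uI (a b : R) : a *: u = b *: u -> a = b.
  move=> /eqP; rewrite -subr_eq0 -scalerBl scaler_eq0 subr_eq0.
  by case/orP => /eqP.
have y'T t x : J t -> y' (T t x) = y' x.
  by move=> Jt; apply: uI; rewrite -!Ey' ET// Ey' linearZ/= Tu.
exists E; first apply: (stable_cvg_opnorm HJ M0 TM TD TC EL EE) => t x Jt.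
  by rewrite Ey' linearZ/= Tu.
move=> _; exists u, y'; split=> //.
- by apply/boundedLinearP/funext => x; rewrite /= Ey'.
- by have [t Jt] := TI u Pu un0; rewrite Tu.
- have y'P : positive_functional P y'.
    move=> x Px; rewrite leNgt; apply/negP => y'x; apply: un0.
    apply: (cone_anti HP) => //.
    have -> : - u = (- y' x)^-1 *: E x.
      by rewrite Ey' scalerA invrN mulNr mulVf ?lt_eqF// scaleN1r.
    apply: (coneZ HP); first by rewrite invr_ge0 oppr_ge0 ltW.
    by apply: (strong_limit_closed EL (cone_closed HP)) => t Jt; exact: TP.
  move=> x Px xn0; have [t Jt Ti] := TI x Px xn0.
  rewrite -(y'T t)//; apply: Ti => // y'0; apply: En0.
  by apply/funext => z; rewrite Ey' y'0 scale0r.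
- by move=> t Jt; apply/boundedLinearP/funext => x /=; exact: y'T.
Qed.
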